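(* Let $X$ be a smooth Banach space with function of smoothness $\psi$. Then, for any $(x,v)\in S(X)\times S(X)$, the limit $$\xi(x,v):=\lim_{t\downarrow0}\frac{\langle J(x+tv),x\rangle-\langle J(x),x\rangle}{t}$$ exists, and $$\psi(x,v)=\frac12\left(\langle J(x),v\rangle+\xi(x,v)\right)\quad\text{for any }(x,v)\in S(X)\times S(X).$$
   Context: All Banach spaces are real; $X^*$ is the topological dual of $X$ and $\langle\cdot,\cdot\rangle$ the pairing between $X^*$ and $X$. $S(X)$ is the unit sphere of $X$. $X$ is smooth if $\lim_{t\to0}\frac{\|x+tv\|-\|x\|}{t}$ exists for all $x,v\in S(X)$. The function of smoothness of a smooth space $X$ is $\psi:S(X)\times S(X)\to\mathbb{R}$, $\psi(x,v)=\lim_{t\downarrow0}\frac{\|x+tv\|-\|x\|}{t}$. $J:X\to X^*$ is the normalized duality mapping, $\langle Jx,x\rangle=\|Jx\|_*\|x\|=\|x\|^2=\|Jx\|_*^2$, which is single-valued since $X$ is smooth. *)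

(* Defs.v *)
From HB Require Import structures.
From mathcomp Require Import all_boot all_order all_algebra.
From mathcomp Require Import all_classical all_reals all_analysis.

Set Implicit Arguments.
Unset Strict Implicit.
Unset Printing Implicit Defensive.

Import Order.TTheory GRing.Theory Num.Theory.
Import numFieldNormedType.Exports.

Local Open Scope classical_set_scope.
Local Open Scope ring_scope.

#[short(type="dualType")]
HB.structure Definition Dual (R : realType) (X : normedModType R) :=
  {f of @isContinuous X R^o f & @GRing.Linear R X R^o *:%R f}.

HB.instance Definition _ (R : realType) (X : normedModType R) :=
  gen_eqMixin (dualType X).
HB.instance Definition _ (R : realType) (X : normedModType R) :=
  gen_choiceMixin (dualType X).

Section Defs.
Context {R : realType} {X : normedModType R}.
Implicit Types (x v : X) (f : dualType X).

Definition pairing f x : R := f x.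

Definition dual_norm f : R :=
  sup [set `|pairing f x| | x in [set x : X | `|x| <= 1]].

Lemma null_dual_continuous : continuous (\0 : X -> R^o).
Proof. by move=> x; exact: cvg_cst. Qed.

HB.instance Definition _ :=
  isContinuous.Build X R^o (\0 : X -> R^o) null_dual_continuous.

Definition null_dual : dualType X := (\0 : X -> R^o).

Definition unit_sphere : set X := [set x | `|x| = 1].

Definition norm_quotient x v (t : R) : R := (`|x + t *: v| - `|x|) / t.

Definition smoothness_fun x v : R :=
  lim (norm_quotient x v t @[t --> 0^'+]).

Definition duality_set x : set (dualType X) :=
  [set f | [/\ pairing f x = dual_norm f * `|x|,
               dual_norm f * `|x| = `|x| ^+ 2 &
               `|x| ^+ 2 = dual_norm f ^+ 2]].

(* [duality_set x] is never empty (Hahn-Banach), so the default value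
   [null_dual] is never used; it is a singleton when [X] is smooth. *)
Definition duality_map x : dualType X := xget null_dual (duality_set x).

Definition duality_quotient x v (t : R) : R :=
  (pairing (duality_map (x + t *: v)) x - pairing (duality_map x) x) / t.

Definition duality_derivative x v : R :=
  lim (duality_quotient x v t @[t --> 0^'+]).

End Defs.

Arguments unit_sphere {R} X.

Definition smooth_space (R : realType) (X : normedModType R) : Prop :=
  forall x v : X, unit_sphere X x -> unit_sphere X v ->
    cvg (norm_quotient x v t @[t --> 0^']).

(* Main.v *)
Require Import Defs.
From HB Require Import structures.
From mathcomp Require Import all_boot all_order all_algebra.
From mathcomp Require Import all_classical all_reals all_analysis.
From mathcomp Require Import ring lra.

(** The whole point is that J(y) is the derivative of half the squared norm:
    <J(y), v> = |y| psi(y, v) for every y <> 0, where psi(y, .) is the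
    directional derivative of the norm.

    This formula also gives the existence of J(y), with no appeal to
    Hahn-Banach.  By convexity psi(y, .) is sublinear; smoothness makes the
    derivative two-sided, hence odd, and a sublinear odd function is linear.
    Moreover |psi(y, v)| <= |v| and psi(y, y) = |y|, so |y| psi(y, .) is a
    continuous functional of norm |y| with the value |y|^2 at y
    ([duality_set_nonempty]).  Conversely any functional f in the duality set
    of y satisfies f(v) <= |y| psi(y, v), because f(y + t v) <= |y| |y + t v|;
    replacing v by -v turns this into an equality ([pairing_duality_map]).

    For the limit, put n(t) = |x + t v|, J_t = J(x + t v) and let
    q(t) = (n(t) - |x|) / t be the quotient of the norm.  Expanding
    J_t(x + t v) = n(t)^2 gives
      (J_t(x) - J(x)(x)) / t = q(t) (n(t) + |x|) - J_t(v),
    and the first term tends to 2 |x| psi(x, v).  For the second, testing J_t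
    at x and at x + 2 t v gives
      n(t) q(t) <= J_t(v) <= n(t) (2 q(2t) - q(t)),
    both bounds tending to |x| psi(x, v), so J_t(v) tends to it as well.  Hence
    xi(x, v) = |x| psi(x, v) = <J(x), v>, and on the unit sphere
    psi(x, v) is the mean of the two ([cvg_duality_quotient]). *)

Import Order.TTheory GRing.Theory Num.Theory.
Import numFieldNormedType.Exports.

Local Open Scope classical_set_scope.
Local Open Scope ring_scope.

(** * Directional derivatives of the norm *)

Lemma cvg_dnbhs0_mull (R : realType) (c : R) : c != 0 ->
  c * t @[t --> 0^'] --> 0^'.
Proof.
move=> c0 A A0.
have cont : {for 0, continuous ( *%R c)} by exact: mulrl_continuous.
have H : \forall t \near (0 : R), c * t != 0 -> A (c * t).
  by apply: (near_fun _ _ (fun u => u != 0 -> A u) cont); rewrite /= mulr0.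
apply: filterS H => t Ht t0.
by apply: Ht; rewrite mulf_neq0.
Qed.

Section DirectionalDerivative.
Context {R : realType} {X : normedModType R}.
Implicit Types (x y u v w : X) (a b t : R).

Lemma norm_quotient0 y t : norm_quotient y 0 t = 0.
Proof. by rewrite /norm_quotient scaler0 addr0 subrr mul0r. Qed.

Lemma norm_quotientZ y v a b t : 0 < a -> b != 0 ->
  norm_quotient (a *: y) (b *: v) t = b * norm_quotient y v (b / a * t).
Proof.
move=> a0 b0; rewrite /norm_quotient.
have -> : a *: y + t *: (b *: v) = a *: (y + (b / a * t) *: v).
  rewrite scalerDr !scalerA; congr (_ + _ *: _).
  by field; rewrite gt_eqF.
rewrite !normrZ (gtr0_norm a0).
have [->|t0] := eqVneq t 0; first by rewrite mulr0 !invr0 !mulr0.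
by field; rewrite b0 t0 gt_eqF.
Qed.

Lemma cvg_norm_quotientZ y v a b (l : R) : 0 < a ->
  norm_quotient y v t @[t --> 0^'] --> l ->
  norm_quotient (a *: y) (b *: v) t @[t --> 0^'] --> b * l.
Proof.
move=> a0 yvl; have [->|b0] := eqVneq b 0.
  rewrite scale0r mul0r (_ : norm_quotient _ _ = fun=> 0); first exact: cvg_cst.
  by apply/funext => t; rewrite norm_quotient0.
rewrite (_ : norm_quotient _ _ = fun t => b * norm_quotient y v (b / a * t)).
  apply: cvgMl_tmp.
  apply: (cvg_comp (fun t => b / a * t) (norm_quotient y v)); last exact: yvl.
  by apply: cvg_dnbhs0_mull; rewrite mulf_neq0// invr_eq0 gt_eqF.
by apply/funext => t; rewrite norm_quotientZ.
Qed.

(** Convexity of the norm at the midpoint of y + 2 t v and y + 2 t w.  The step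
    2 t is written as the direction 2 v with step t, so that the limit t -> 0
    only needs homogeneity in the direction and no change of variable. *)
Lemma norm_quotientD_le y v w t : 0 < t ->
  norm_quotient y (v + w) t <=
  2^-1 * (norm_quotient y (2 *: v) t + norm_quotient y (2 *: w) t).
Proof.
move=> t0; rewrite /norm_quotient -mulrDl mulrA ler_pM2r ?invr_gt0//.
have : `|2 *: (y + t *: (v + w))| <=
    `|y + t *: (2 *: v)| + `|y + t *: (2 *: w)|.
  have -> : 2 *: (y + t *: (v + w)) =
      (y + t *: (2 *: v)) + (y + t *: (2 *: w)).
    rewrite addrACA -mulr2n scalerDr scaler_nat; congr (_ + _).
    by rewrite -!scalerDr !scalerA mulrC.
  exact: ler_normD.
rewrite normrZ gtr0_norm//; lra.
Qed.

Lemma norm_quotient_le y v t : 0 < t -> norm_quotient y v t <= `|v|.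
Proof.
move=> t0; rewrite /norm_quotient ler_pdivrMr// lerBlDl.
by rewrite (le_trans (ler_normD _ _))// normrZ gtr0_norm// mulrC.
Qed.

Hypothesis smoothX : smooth_space X.

(** Smoothness is assumed on the unit sphere only; homogeneity of the quotient
    carries it to every base point y <> 0 and every direction. *)
Lemma smooth_norm_quotient_cvg y v : y != 0 ->
  norm_quotient y v t @[t --> 0^'] --> smoothness_fun y v.
Proof.
move=> y0; suff cyv : cvg (norm_quotient y v t @[t --> 0^']).
  by rewrite /smoothness_fun -cvg_at_rightE.
have ny0 : 0 < `|y| by rewrite normr_gt0.
have normalize u : u != 0 -> unit_sphere X (`|u|^-1 *: u).
  by move=> u0; rewrite /unit_sphere/= normrZ normfV normr_id mulVf ?normr_eq0.
have unnormalize u : u != 0 -> `|u| *: (`|u|^-1 *: u) = u.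
  by move=> u0; rewrite scalerA mulfV ?normr_eq0// scale1r.
have [->|v0] := eqVneq v 0.
  rewrite (_ : norm_quotient _ _ = fun=> 0); first exact: is_cvg_cst.
  by apply/funext => t; rewrite norm_quotient0.
have /cvg_norm_quotientZ := smoothX _ _ (normalize _ y0) (normalize _ v0).
move=> /(_ `|y| `|v| ny0); rewrite !unnormalize// => H.
by apply/cvg_ex; eexists; exact: H.
Qed.

Lemma smoothness_funE y v (l : R) : y != 0 ->
  norm_quotient y v t @[t --> 0^'] --> l -> smoothness_fun y v = l.
Proof.
move=> y0; exact: cvg_unique (smooth_norm_quotient_cvg _ _ y0).
Qed.

Lemma smoothness_funZ y v b : y != 0 ->
  smoothness_fun y (b *: v) = b * smoothness_fun y v.
Proof.
move=> y0; apply: smoothness_funE => //.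
rewrite -[in X in norm_quotient X](scale1r y).
exact: cvg_norm_quotientZ (smooth_norm_quotient_cvg _ _ y0).
Qed.

Lemma smoothness_funN y v : y != 0 ->
  smoothness_fun y (- v) = - smoothness_fun y v.
Proof. by move=> y0; rewrite -scaleN1r smoothness_funZ// mulN1r. Qed.

Lemma smoothness_fun_cvg_right y v : y != 0 ->
  norm_quotient y v t @[t --> 0^'+] --> smoothness_fun y v.
Proof.
by move=> y0; exact: cvg_dnbhs_at_right (smooth_norm_quotient_cvg _ _ y0).
Qed.

Lemma smoothness_funD_le y v w : y != 0 ->
  smoothness_fun y (v + w) <= smoothness_fun y v + smoothness_fun y w.
Proof.
move=> y0.
have -> : smoothness_fun y v + smoothness_fun y w =
    2^-1 * (smoothness_fun y (2 *: v) + smoothness_fun y (2 *: w)).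
  by rewrite !smoothness_funZ//; field.
apply: (ler_cvg_to (smoothness_fun_cvg_right _ _ y0)).
  by apply: cvgMl_tmp; apply: cvgD; exact: smoothness_fun_cvg_right y0.
by near=> t; apply: norm_quotientD_le.
Unshelve. all: by end_near. Qed.

(** Subadditivity applied to -v and -w is the reverse inequality, since the
    two-sided limit is odd in the direction. *)
Lemma smoothness_funD y v w : y != 0 ->
  smoothness_fun y (v + w) = smoothness_fun y v + smoothness_fun y w.
Proof.
move=> y0; apply/eqP; rewrite eq_le smoothness_funD_le//=.
have := smoothness_funD_le y (- v) (- w) y0.
by rewrite -opprD !smoothness_funN// -opprD lerN2.
Qed.

Lemma smoothness_fun_le y v : y != 0 -> `|smoothness_fun y v| <= `|v|.
Proof.
move=> y0; have le u : smoothness_fun y u <= `|u|.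
  apply: (cvgr_to_le (smoothness_fun_cvg_right y u y0)).
  by near=> t; apply: norm_quotient_le.
by rewrite ler_norml le andbT lerNl -smoothness_funN// -[leRHS]normrN le.
Unshelve. all: by end_near. Qed.

Lemma smoothness_fun_self y : y != 0 -> smoothness_fun y y = `|y|.
Proof.
move=> y0; apply: cvg_lim => //.
apply: cvg_near_cst; near=> t.
have t0 : 0 < t by [].
rewrite /norm_quotient -{1}(scale1r y) -scalerDl normrZ gtr0_norm; last lra.
by field; rewrite gt_eqF.
Unshelve. all: by end_near. Qed.

End DirectionalDerivative.

(** * The duality mapping of a smooth space *)

Section Duality.
Context {R : realType} {X : normedModType R}.
Implicit Types (x y z v : X) (f : dualType X).

Lemma dual_norm_has_sup f :
  has_sup [set `|pairing f x| | x in [set x : X | `|x| <= 1]].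
Proof.
split; first by exists `|pairing f 0|, 0 => //=; rewrite normr0 ler01.
have /linear_bounded_continuous/linear_boundedP := @cts_fun _ _ f.
move=> [M [Mreal HM]].
have /(HM _) HM1 : M < `|M| + 1 by rewrite (le_lt_trans (ler_norm M))// ltrDl.
exists (`|M| + 1) => _ [x /= x1 <-].
apply: (le_trans (HM1 x)); rewrite -[leRHS]mulr1.
by rewrite ler_wpM2l.
Qed.

Lemma le_dual_norm f z : `|pairing f z| <= dual_norm f * `|z|.
Proof.
have [->|z0] := eqVneq z 0.
  by rewrite /pairing raddf0 !normr0 mulr0.
have nz : 0 < `|z| by rewrite normr_gt0.
rewrite -ler_pdivrMr//.
apply: sup_upper_bound; first exact: dual_norm_has_sup.
exists (`|z|^-1 *: z); first by rewrite /= normrZ normfV normr_id mulVf ?gt_eqF.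
by rewrite /pairing linearZ/= normrM normfV normr_id mulrC.
Qed.

Lemma dual_norm_attained f y (c : R) : y != 0 ->
  (forall z, `|pairing f z| <= c * `|z|) -> pairing f y = c * `|y| ->
  dual_norm f = c.
Proof.
move=> y0 fc fy; have ny : 0 < `|y| by rewrite normr_gt0.
have c0 : 0 <= c.
  by have := le_trans (normr_ge0 _) (fc y); rewrite pmulr_lge0.
apply/eqP; rewrite eq_le; apply/andP; split.
  apply: ge_sup; first by have [] := dual_norm_has_sup f.
  by move=> _ [x /= x1 <-]; rewrite (le_trans (fc x))// ler_piMr.
rewrite -(ler_pM2r ny) -fy; exact: le_trans (ler_norm _) (le_dual_norm _ _).
Qed.

Lemma dual_of_bounded_linear (g : X -> R) (c : R) :
  (forall u v, g (u + v) = g u + g v) ->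
  (forall a v, g (a *: v) = a * g v) ->
  (forall v, `|g v| <= c * `|v|) ->
  exists f : dualType X, forall v, pairing f v = g v.
Proof.
move=> gD gZ gc; pose h : X -> R^o := g.
have hlin : linear h by move=> a u v; rewrite /h gD gZ.
pose hL := GRing.isLinear.Build R X R^o *:%R h hlin.
pose L : {linear X -> R^o} := HB.pack h hL.
have hcont : continuous h.
  apply/(@linear_bounded_continuous _ _ _ L)/linear_boundedP.
  near=> r => v; apply: (le_trans (gc v)); apply: ler_wpM2r => //.
pose hC := isContinuous.Build X R^o h hcont.
pose f : dualType X := HB.pack h hL hC.
by exists f.
Unshelve. all: by end_near. Qed.

Hypothesis smoothX : smooth_space X.

(** The support functional at y is |y| psi(y, .), the derivative of half the
    squared norm. *)
Lemma duality_set_nonempty y : y != 0 -> exists f, duality_set y f.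
Proof.
move=> y0; have gle v : `| `|y| * smoothness_fun y v| <= `|y| * `|v|.
  by rewrite normrM normr_id ler_wpM2l// smoothness_fun_le.
have [| |f fE] := dual_of_bounded_linear _ _ _ _ gle.
- by move=> u v; rewrite smoothness_funD// mulrDr.
- by move=> a v; rewrite smoothness_funZ// mulrCA.
exists f; have fy : pairing f y = `|y| * `|y|.
  by rewrite fE smoothness_fun_self.
have nf : dual_norm f = `|y|.
  by apply: (dual_norm_attained _ y) => // z; rewrite fE.
by split; rewrite ?nf ?fy ?expr2.
Qed.

(** Cancelling |y| in the second equation of the duality set shows that J(y)
    has dual norm |y|. *)
Lemma duality_mapP y : y != 0 ->
  pairing (duality_map y) y = `|y| ^+ 2 /\
  forall z, pairing (duality_map y) z <= `|y| * `|z|.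
Proof.
move=> y0; rewrite /duality_map.
have [H1 H2 H3] := xgetPex null_dual (duality_set_nonempty _ y0).
split=> [|z]; first by rewrite H1 H2.
have -> : `|y| = dual_norm (xget null_dual (duality_set y)).
  apply: (@mulIf _ `|y|); first by rewrite normr_eq0.
  by rewrite H2.
exact: le_trans (ler_norm _) (le_dual_norm _ _).
Qed.

(** Dividing <J(y), y + t u> <= |y| |y + t u| by t > 0 and letting t -> 0 bounds
    <J(y), u> by the derivative; both sides are odd in u, so they agree. *)
Lemma pairing_duality_map y v : y != 0 ->
  pairing (duality_map y) v = `|y| * smoothness_fun y v.
Proof.
move=> y0; have [Jy Jle] := duality_mapP _ y0.
have ny : 0 < `|y| by rewrite normr_gt0.
have le u : pairing (duality_map y) u <= `|y| * smoothness_fun y u.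
  rewrite -ler_pdivrMl//.
  apply: (cvgr_to_ge (smoothness_fun_cvg_right smoothX y u y0)).
  near=> t; have t0 : 0 < t by [].
  rewrite /norm_quotient ler_pdivlMr// -mulrA ler_pdivrMl//.
  have := Jle (y + t *: u).
  have -> : pairing (duality_map y) (y + t *: u) =
      `|y| ^+ 2 + t * pairing (duality_map y) u.
    by rewrite -Jy /pairing linearD linearZ.
  lra.
apply/eqP; rewrite eq_le le/=.
have := le (- v); rewrite smoothness_funN// /pairing linearN/= mulrN.
by rewrite lerN2.
Unshelve. all: by end_near. Qed.

(** The slope of a subgradient at x + t v lies between the slopes of the chords
    of the norm over [x, x + t v] and [x + t v, x + 2 t v]. *)
Lemma pairing_duality_map_chord_bounds x v (t : R) : 0 < t -> x + t *: v != 0 ->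
  `|x + t *: v| * norm_quotient x v t
    <= pairing (duality_map (x + t *: v)) v
    <= `|x + t *: v| * (norm_quotient x (2 *: v) t - norm_quotient x v t).
Proof.
move=> t0 y0; have [Jy Jle] := duality_mapP _ y0.
set J := duality_map _ in Jy Jle *; set n := `|x + t *: v| in Jy Jle *.
have JD : pairing J x + t * pairing J v = n ^+ 2.
  by rewrite -Jy /pairing linearD linearZ.
have Jx := Jle x.
have := Jle (x + t *: (2 *: v)).
have -> : pairing J (x + t *: (2 *: v)) = pairing J x + t * (2 * pairing J v).
  by rewrite /pairing linearD !linearZ.
rewrite /norm_quotient -/n => Jx2; apply/andP; split.
  by rewrite mulrA ler_pdivrMr//; lra.
by rewrite -mulrBl mulrA ler_pdivlMr//; lra.
Qed.

Lemma cvg_norm_line x v : `|x + t *: v| @[t --> (0 : R)^'+] --> `|x|.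
Proof.
have -> : `|x| = `|x + (0 : R) *: v| by rewrite scale0r addr0.
apply: cvg_at_right_filter; apply: cvg_norm; apply: cvgD; first exact: cvg_cst.
exact: scalel_continuous.
Qed.

Lemma near_line_neq0 x v : x != 0 ->
  \forall t \near (0 : R)^'+, x + t *: v != 0.
Proof.
move=> x0; have nx0 : `|x| != 0 by rewrite normr_eq0.
near=> t; rewrite -normr_eq0; near: t.
exact: cvgr_neq0 (cvg_norm_line x v) nx0.
Unshelve. all: by end_near. Qed.

(** J is continuous along rays when tested in the direction of the ray. *)
Lemma cvg_pairing_duality_map x v : x != 0 ->
  pairing (duality_map (x + t *: v)) v @[t --> 0^'+] -->
  `|x| * smoothness_fun x v.
Proof.
move=> x0; set s := smoothness_fun x v.
have qs : norm_quotient x v t @[t --> 0^'+] --> s.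
  exact: smoothness_fun_cvg_right.
have q2s : norm_quotient x (2 *: v) t @[t --> 0^'+] --> 2 * s.
  by rewrite -smoothness_funZ//; exact: smoothness_fun_cvg_right.
apply: (@squeeze_cvgr _ _ _ _ (fun t => `|x + t *: v| * norm_quotient x v t)
    (fun t => `|x + t *: v| *
      (norm_quotient x (2 *: v) t - norm_quotient x v t))).
- near=> t; apply: pairing_duality_map_chord_bounds => //.
  by near: t; exact: near_line_neq0.
- by apply: cvgM => //; exact: cvg_norm_line.
- rewrite (_ : `|x| * s = `|x| * (2 * s - s)); last by ring.
  by apply: cvgM; [exact: cvg_norm_line|exact: cvgB].
Unshelve. all: by end_near. Qed.

Lemma cvg_duality_quotient x v : x != 0 ->
  duality_quotient x v t @[t --> 0^'+] --> `|x| * smoothness_fun x v.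
Proof.
move=> x0; set s := smoothness_fun x v.
have H : norm_quotient x v t * (`|x + t *: v| + `|x|) -
    pairing (duality_map (x + t *: v)) v @[t --> 0^'+] --> `|x| * s.
  rewrite (_ : `|x| * s = s * (`|x| + `|x|) - `|x| * s); last by ring.
  apply: cvgB; last exact: cvg_pairing_duality_map.
  apply: cvgM; first exact: smoothness_fun_cvg_right.
  by apply: cvgD; [exact: cvg_norm_line|exact: cvg_cst].
apply: cvg_trans H; apply: near_eq_cvg; near=> t.
have t0 : 0 < t by [].
have y0 : x + t *: v != 0 by near: t; exact: near_line_neq0.
have [Jxx _] := duality_mapP _ x0; have [Jy _] := duality_mapP _ y0.
rewrite /duality_quotient Jxx /norm_quotient.
set J := duality_map _ in Jy *.
have -> : pairing J x = `|x + t *: v| ^+ 2 - t * pairing J v.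
  by rewrite -Jy /pairing linearD linearZ/= addrK.
by field; rewrite gt_eqF.
Unshelve. all: by end_near. Qed.

End Duality.

Theorem lemma2p2 (R : realType) (X : completeNormedModType R)
    (smoothX : smooth_space X) :
  forall x v : X, unit_sphere X x -> unit_sphere X v ->
    cvg (duality_quotient x v t @[t --> 0^'+]) /\
    smoothness_fun x v =
      2^-1 * (pairing (duality_map x) v + duality_derivative x v).
Proof.
move=> x v x1 _.
have {}x1 : `|x| = 1 := x1.
have x0 : x != 0 by rewrite -normr_eq0 x1 oner_eq0.
have dq := cvg_duality_quotient smoothX x v x0.
split; first by apply/cvg_ex; exists (`|x| * smoothness_fun x v).
rewrite /duality_derivative (cvg_lim _ dq)// pairing_duality_map// x1.
by field.
Qed.
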